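(* Let $G$ be a locally compact Hausdorff topological group and $f\in\mathrm{A}_c(G)$. Then every endomorphism of the left flow $G\curvearrowright X_f$ (respectively, of the right flow $X_f\curvearrowleft G$) is almost 1-1.
   Context: For $f:G\to\mathbb{C}$ and $t\in G$ let $(ft)(x)=f(tx)$ and $(tf)(x)=f(xt)$. $f$ is left almost automorphic if every net $\{t_n\}$ in $G$ has a subnet $\{t_{n'}\}$ and there is a continuous $\phi:G\to\mathbb{C}$ with $t_{n'}f\to\phi$ and $t_{n'}^{-1}\phi\to f$ pointwise; right almost automorphic is defined analogously with $ft_{n'}\to\phi$ and $\phi t_{n'}^{-1}\to f$. $\mathrm{A}_c(G)$ is the set of functions that are both left and right almost automorphic (Bochner a.a. functions); for $G$ locally compact such functions are bounded and both left and right uniformly continuous. Veech's hull: let $\xi_f:G\times G\to\mathbb{C}$, $\xi_f(s,t)=f(st)$. For $x:G\times G\to\mathbb{C}$ bounded and $\tau_1,\tau_2\in G$ put $(\tau_1x\tau_2)(s,t)=x(s\tau_1,\tau_2t)$. Then $\tau\xi_f=\xi_f\tau$, and $X_f$ is the closure of $G\xi_f=\xi_fG$ in the topology of pointwise convergence on $G\times G$. With these actions $X_f$ is a compact Hausdorff space carrying jointly continuous commuting left and right actions of $G$, both minimal. An endomorphism of a flow is a continuous equivariant self-map; on a minimal compact flow it is automatically surjective. A continuous equivariant surjection $\phi:X\to Y$ of minimal compact flows is almost 1-1 if there is $x\in X$ with $\phi^{-1}(\phi(x))=\{x\}$. *)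

(* Defs.v *)
From HB Require Import structures.
From mathcomp Require Import all_boot all_order all_algebra.
From mathcomp Require Import complex.
From mathcomp Require Import all_classical all_reals all_analysis.

Set Implicit Arguments.
Unset Strict Implicit.
Unset Printing Implicit Defensive.

Import numFieldNormedType.Exports.
Local Open Scope classical_set_scope.
Local Open Scope group_scope.

HB.mixin Record isTopologicalGroup G of Topological G & Group G := {
  mulg_continuous : continuous (fun xy : G * G => xy.1 * xy.2);
  invg_continuous : continuous (fun x : G => x^-1)
}.

#[short(type="topologicalGroupType")]
HB.structure Definition TopologicalGroup :=
  {G of Topological G & Group G & isTopologicalGroup G}.

Record directedSet := DirectedSet {
  dir_sort :> Type;
  dir_le : dir_sort -> dir_sort -> Prop;
  dir_refl : forall i, dir_le i i;
  dir_trans : forall i j k, dir_le i j -> dir_le j k -> dir_le i k;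
  dir_inhabited : inhabited dir_sort;
  dir_ub : forall i j, exists2 k, dir_le i k & dir_le j k
}.

(* A net in T is a function t : I -> T on a directed set I; it converges to l
   iff t @ tails I --> l. *)
Definition tails (I : directedSet) : set_system I :=
  [set A | exists i0 : I, forall i, dir_le i0 i -> A i].
Arguments tails : clear implicits.

(* The subnets of t : I -> T are the t \o h with h : J -> I cofinal in the sense
   of Kelley; h is not required to be monotone. *)
Definition cofinal (J I : directedSet) (h : J -> I) : Prop :=
  forall i0 : I, exists j0 : J, forall j, dir_le j0 j -> dir_le i0 (h j).

Section AlmostAutomorphic.
Context {R : realType} {G : topologicalGroupType}.
Implicit Types f : G -> R[i]^o.

(* ltrans t f is written tf, and rtrans f t is written ft: the side on which t
   is written is opposite to the side on which it multiplies the argument. *)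
Definition ltrans (t : G) f : G -> R[i]^o := fun x => f (x * t).
Definition rtrans f (t : G) : G -> R[i]^o := fun x => f (t * x).

Definition left_almost_automorphic f : Prop :=
  forall (I : directedSet) (t : I -> G),
  exists (J : directedSet) (h : J -> I) (phi : G -> R[i]^o),
    [/\ cofinal h, continuous phi,
        forall x, ltrans (t (h j)) f x @[j --> tails J] --> phi x &
        forall x, ltrans (t (h j))^-1 phi x @[j --> tails J] --> f x].

Definition right_almost_automorphic f : Prop :=
  forall (I : directedSet) (t : I -> G),
  exists (J : directedSet) (h : J -> I) (phi : G -> R[i]^o),
    [/\ cofinal h, continuous phi,
        forall x, rtrans f (t (h j)) x @[j --> tails J] --> phi x &
        forall x, rtrans phi (t (h j))^-1 x @[j --> tails J] --> f x].

Definition bochner_aa f : Prop :=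
  left_almost_automorphic f /\ right_almost_automorphic f.

Definition xi f : {ptws G * G -> R[i]^o} := fun st => f (st.1 * st.2).

Definition biact (t1 : G) (x : {ptws G * G -> R[i]^o}) (t2 : G) :
    {ptws G * G -> R[i]^o} :=
  fun st => x (st.1 * t1, t2 * st.2).

Definition lact (t : G) x := biact t x 1.
Definition ract (t : G) x := biact 1 x t.

Lemma lact_xi t f : lact t (xi f) = ract t (xi f).
Proof.
apply/funext => -[s u].
by rewrite /lact /ract /biact /xi /= mul1g mulg1 mulgA.
Qed.

(* The ambient space contains the unbounded functions as well; when f is bounded
   so are, uniformly, all members of the closure. *)
Definition hull f : set {ptws G * G -> R[i]^o} :=
  closure [set lact t (xi f) | t in [set: G]].

End AlmostAutomorphic.

(* Flows are given as invariant subspaces X of a space S on which G acts by aX;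
   maps between them are maps of the ambient spaces, of which only the
   restriction to X matters. A right action is passed as g x |-> x g, which
   does not affect equivariance. *)
Section Flows.
Context {G : Type} {S T : topologicalType}.
Variables (aX : G -> S -> S) (X : set S) (aY : G -> T -> T) (Y : set T).

Definition flow_hom (phi : S -> T) : Prop :=
  [/\ {within X, continuous phi}, set_fun X Y phi &
      forall g x, X x -> phi (aX g x) = aY g (phi x)].

Definition almost_1_1 (phi : S -> T) : Prop :=
  [/\ flow_hom phi, set_surj X Y phi &
      exists2 x, X x & X `&` phi @^-1` [set phi x] = [set x]].

End Flows.

Definition flow_endomorphism (G : Type) (S : topologicalType)
    (a : G -> S -> S) (X : set S) (phi : S -> S) : Prop :=
  flow_hom a X a X phi.

(* Main.v *)
Require Import Defs.
From HB Require Import structures.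
From mathcomp Require Import all_boot all_order all_algebra.
From mathcomp Require Import complex.
From mathcomp Require Import all_classical all_reals all_analysis.
Set Implicit Arguments.
Unset Strict Implicit.
Unset Printing Implicit Defensive.
Import numFieldNormedType.Exports.
Local Open Scope classical_set_scope.
Local Open Scope group_scope.

(** Write xi for the point [xi f] and X for its hull. Left almost automorphy of
    [f] makes X compact and makes xi an almost automorphic point of the left
    flow: if t_n xi tends to z, then t_n^-1 z tends to xi
    ([lact_almost_automorphic]). The theorem holds for every compact orbit
    closure X of an almost automorphic point xi under an action by
    homeomorphisms ([endo_almost_1_1]): the fibre of an endomorphism phi through
    xi is reduced to xi.

    If the topology of X came from an invariant metric, this would be clear: by
    compactness some phi^m xi with m > 0 is close to xi, by invariance phi^m
    moves every point as little as it moves xi, and phi^m x = phi^m xi forces x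
    to be close to xi. In general one works instead with the return times
    C(W) = {t | t xi in W} of xi to its neighbourhoods W. The key step, due to
    Veech, is that they behave like the neighbourhoods of 1 in a topological
    group: every C(W) contains some C(V) C(V) and some C(V) C(V)^-1
    ([return_times_mul], [return_times_divr]). It has two consequences.

    First, xi is recurrent under phi: every W contains phi^m xi for some m > 0
    ([endo_recurrent]). By compactness and minimality, two iterates phi^i xi and
    phi^j xi with i < j lie in a common translate of a small neighbourhood of
    xi. If g_i xi and g_j xi approximate them, then g_i^-1 g_j is a quotient of
    return times, hence a return time, and g_i^-1 g_j xi is close to
    phi^(j-i) xi.

    Secondly, suppose that phi x = phi xi, and choose m > 0 with phi^m xi close
    to xi. If r xi is close to x, then r phi^m xi = phi^m (r xi) is close to
    phi^m x = phi^m xi, hence to xi. With g xi close enough to phi^m xi, both g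
    and r g are return times of xi to a small neighbourhood, so r = (r g) g^-1
    returns xi to a prescribed one. Thus r xi is close both to x and to xi, and
    x = xi ([endo_fiber_base]).

    The right flow is the left flow of the action of t^-1 on the right, and
    right almost automorphy makes xi an almost automorphic point of it. *)

(** * Separation *)

Lemma regular_closed_nbhs (S : topologicalType) (x : S) (W : set S) :
  regular_space S -> nbhs x W -> exists V, [/\ nbhs x V, closed V & V `<=` W].
Proof.
move=> regS /regS[V nV sVW]; exists (closure V); split => //.
  by apply: filterS nV; exact: subset_closure.
exact: closed_closure.
Qed.

Lemma hausdorff_disjoint_nbhs (S : topologicalType) (x y : S) :
  hausdorff_space S -> x <> y ->
  exists A B, [/\ nbhs x A, nbhs y B & forall z, A z -> B z -> False].
Proof.
move=> hS neq; apply: contrapT => H; apply: neq; apply: hS => A B nA nB.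
apply: contrapT => /nonemptyPn AB0; apply: H; exists A, B; split => // z Az Bz.
have : (A `&` B) z by [].
by rewrite AB0.
Qed.

(** * Flows generated by an almost automorphic point *)

Section Flow.
Context {G : groupType} {S : topologicalType} (a : G -> S -> S).

(** That t_n^-1 z tends to xi whenever t_n xi tends to z, stated without nets. *)
Definition almost_automorphic_point (xi : S) : Prop :=
  forall z, closure (range (fun t => a t xi)) z -> forall W, nbhs xi W ->
  exists2 U, nbhs z U & forall t, U (a t xi) -> W (a t^-1 z).

Hypotheses (regS : regular_space S) (hS : hausdorff_space S).
Hypotheses (a1 : forall x, a 1 x = x).
Hypotheses (aM : forall g h x, a (g * h) x = a g (a h x)).
Hypotheses (ac : forall g, continuous (a g)).
Variable (xi : S).
Let X := closure (range (fun t => a t xi)).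
Hypotheses (cX : compact X) (xiaa : almost_automorphic_point xi).

Lemma nbhs_act g x (W : set S) : nbhs (a g x) W -> nbhs x (fun y => W (a g y)).
Proof. by move=> nW; apply: ac. Qed.

Lemma orbit_hull t : X (a t xi).
Proof. by apply: subset_closure; exists t. Qed.

Lemma base_hull : X xi.
Proof. by rewrite -(a1 xi); exact: orbit_hull. Qed.

Lemma hull_act g x : X x -> X (a g x).
Proof.
move=> Xx B /nbhs_act /Xx [_ [[t _ <-] /= Bt]].
by exists (a g (a t xi)); split => //; exists (g * t) => //; rewrite aM.
Qed.

Lemma hull_approx x (U : set S) : X x -> nbhs x U -> exists t, U (a t xi).
Proof. by move=> Xx /Xx [_ [[t _ <-] Ut]]; exists t. Qed.

(** This is minimality: X is the orbit closure of xi, hence of any z in X. *)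
Lemma base_in_orbit_closure z (W : set S) :
  X z -> nbhs xi W -> exists t, W (a t z).
Proof.
move=> Xz nW; have [U nU UW] := xiaa Xz nW.
by have [t /UW ?] := hull_approx Xz nU; exists t^-1.
Qed.

Lemma base_return_inv (W : set S) : nbhs xi W ->
  exists2 U, nbhs xi U & forall t, U (a t xi) -> W (a t^-1 xi).
Proof. exact: xiaa base_hull W. Qed.

Lemma seq_cluster (u : nat -> S) : (forall n, X (u n)) -> exists2 z, X z &
  forall U, nbhs z U -> forall n, exists2 k, n <= k & U (u k).
Proof.
move=> Xu.
have [|z [Xz uz]] := @cX (u @ \oo) _; first by exists 0 => // n _ /=; exact: Xu.
exists z => // U nU n.
have /uz /(_ nU)[_ [[k nk <-] Uk]] :
    (u @ \oo) [set u k | k in [set k | n <= k]%N].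
  by exists n => // k /= nk; exists k.
by exists k.
Qed.

(** If s_j xi accumulates at z, then s_i^-1 z is close to xi for some i with
    s_i xi close to z, and hence so is s_i^-1 s_j xi for suitable large j. *)
Lemma no_escaping_differences (s : nat -> G) (W : set S) : nbhs xi W ->
  exists i j, i < j /\ W (a ((s i)^-1 * s j) xi).
Proof.
move=> nW; have [|z Xz zc] := @seq_cluster (fun n => a (s n) xi).
  by move=> n; exact: orbit_hull.
have [U nU UW] := xiaa Xz (nbhs_interior nW).
have [i _ /UW/nbhs_act /zc /(_ i.+1)[j ij Wj]] := zc _ nU 0.
by exists i, j; split => //; rewrite aM.
Qed.

(** Otherwise there are t_k and u_k, returning xi to smaller and smaller
    neighbourhoods, for which t_k u_k xi stays outside W. Put
    s_i = u_1 ... u_i t_(i+1)^-1. For i < j the common prefix cancels, and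
    s_i^-1 s_j = t_(i+1) u_(i+1) ... u_j t_(j+1)^-1. If the neighbourhoods shrink
    fast enough, the factors after u_(i+1) do not move
    t_(i+1) u_(i+1) xi much, so that s_i^-1 s_j xi avoids a neighbourhood of xi:
    this contradicts [no_escaping_differences]. *)
Lemma return_times_mul (W : set S) : nbhs xi W ->
  exists2 V, nbhs xi V &
    forall t u, V (a t xi) -> V (a u xi) -> W (a (t * u) xi).
Proof.
move=> /(regular_closed_nbhs regS)[W' [nW' cW' sW'W]].
apply: contrapT => H.
(* [V'] is the neighbourhood that follows [V]: it controls what may still be
   multiplied on the right of t u. *)
pose good (V V' : set S) (t u : G) := [/\ nbhs xi V', V (a t^-1 xi),
  forall y, V' y -> V (a u y) & forall y, V' y -> ~ W' (a (t * u) y)].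
pose step (p q : set S * (G * G)) :=
  nbhs xi p.1 -> good p.1 q.1 q.2.1 q.2.2.
have stepP p : {q | step p q}.
  apply: cid; case: p => V p.
  have [nV|nV] := pselect (nbhs xi V); last by exists (V, p) => /nV.
  have [U nU UV] := base_return_inv nV.
  have nV' := nbhs_interior nV.
  have : ~ forall t u, (V° `&` U) (a t xi) -> (V° `&` U) (a u xi) ->
    W (a (t * u) xi).
    by move=> K; apply: H; exists (V° `&` U) => //; exact: filterI.
  move=> /existsNP[t /existsNP[u /not_implyP[[_ Ut] /not_implyP[[Vu _] nWtu]]]].
  have nW'C : nbhs (a (t * u) xi) (~` W').
    by apply: open_nbhs_nbhs; split; [exact: closed_openC | move/sW'W].
  exists ((fun y => V (a u y)) `&` (fun y => (~` W') (a (t * u) y)), (t, u)).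
  move=> _; split => /=.
  - apply: filterI; [exact: (nbhs_act Vu) | exact: (nbhs_act nW'C)].
  - exact: UV.
  - by move=> y [].
  - by move=> y [].
(* The element (1, 1) with index 0 is a placeholder: t and u start at 1. *)
have [q [q0 qS]] := dependent_choice stepP (setT, (1, 1)).
pose V n := (q n).1; pose t n := (q n).2.1; pose u n := (q n).2.2.
have nV n : nbhs xi (V n).
  elim: n => [|n IH]; first by rewrite /V q0; exact: filterT.
  by have [] := qS n IH.
have Vt n : V n (a (t n.+1)^-1 xi) by have [] := qS n (nV n).
have Vu n y : V n.+1 y -> V n (a (u n.+1) y).
  by move: y; have [] := qS n (nV n).
have Wtu n y : V n.+1 y -> ~ W' (a (t n.+1 * u n.+1) y).
  by move: y; have [] := qS n (nV n).
(* p n = u_1 ... u_n *)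
pose p := fix p n := if n is m.+1 then p m * u m.+1 else 1.
have Vp i d y : V (i + d) y -> V i (a ((p i)^-1 * p (i + d)) y).
  elim: d y => [|d IH] y; first by rewrite addn0 mulVg a1.
  rewrite addnS => /Vu /IH.
  by rewrite /= !aM.
have [i [j [ij]]] := no_escaping_differences (fun n => p n * (t n.+1)^-1) nW'.
rewrite -(subnKC ij); set d := (j - i.+1)%N.
move=> W'ij; apply: (Wtu i _ (Vp i.+1 d _ (Vt _))).
rewrite -!aM; congr (W' (a _ xi)): W'ij.
by rewrite /= !invgM !invgK !mulgA mulgK.
Qed.

Lemma return_times_divr (W : set S) : nbhs xi W -> exists2 V, nbhs xi V &
  forall t u, V (a t xi) -> V (a u xi) -> W (a (t * u^-1) xi).
Proof.
move=> /return_times_mul[V nV VW]; have [U nU UV] := base_return_inv nV.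
by exists (U `&` V) => [|t u [_ ?] [/UV ? _]]; [exact: filterI | exact: VW].
Qed.

Lemma return_times_divl (W : set S) : nbhs xi W -> exists2 V, nbhs xi V &
  forall t u, V (a t xi) -> V (a u xi) -> W (a (t^-1 * u) xi).
Proof.
move=> /return_times_mul[V nV VW]; have [U nU UV] := base_return_inv nV.
by exists (U `&` V) => [|t u [/UV ? _] [_ ?]]; [exact: filterI | exact: VW].
Qed.

Lemma flow_hom_nbhs (psi : S -> S) x (W : set S) : flow_hom a X a X psi ->
  X x -> nbhs (psi x) W -> nbhs x (fun y => X y -> W (psi y)).
Proof. by move=> [/subspace_continuousP psic _ _] Xx; exact: psic. Qed.

Lemma flow_hom_iter phi m :
  flow_hom a X a X phi -> flow_hom a X a X (iter m phi).
Proof.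
move=> phiX; elim: m => [|m IH].
  by split => //=; apply: continuous_subspaceT => x; exact: cvg_id.
have [_ IHX IHa] := IH; have [_ pX pa] := phiX; split => /=.
- apply/subspace_continuousP => x Xx W.
  move=> /(flow_hom_nbhs phiX (IHX _ Xx))/(flow_hom_nbhs IH Xx).
  by apply: filterS => y /= H Xy; exact: H Xy (IHX _ Xy).
- by move=> x /IHX /pX.
- by move=> g x Xx; rewrite IHa// pa//; exact: IHX.
Qed.

Section Endomorphism.
Variable (phi : S -> S).
Hypothesis phiX : flow_hom a X a X phi.

(** The image is closed and invariant, and X is minimal. *)
Lemma endo_surj : set_surj X X phi.
Proof.
have [phic pX pa] := phiX.
have cl : closed (phi @` X).
  by apply: compact_closed => //; exact: continuous_compact.
have orb t : (phi @` X) (a t xi).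
  apply/cl => B /nbhs_act nB.
  have [g Bg] := base_in_orbit_closure (pX _ base_hull) nB.
  exists (a t (a g (phi xi))); split => //.
  exists (a t (a g xi)); first by do 2 apply: hull_act; exact: base_hull.
  by rewrite !pa//; [exact: base_hull | apply: hull_act; exact: base_hull].
move=> y Xy; apply/cl => B /Xy[_ [[t _ <-] Bt]].
by exists (a t xi); split.
Qed.

(** Let f carry a cluster point z of the sequence phi^n xi close to xi. Then f
    carries some phi^i xi and phi^j xi, with i < j, close to xi as well. Choose
    first g_i with g_i xi close to phi^i xi, so close that g_i^-1 phi^i xi is
    near xi, and hence g_i^-1 phi^j xi = phi^(j-i) (g_i^-1 phi^i xi) near
    phi^(j-i) xi; then choose g_j with g_j xi close to phi^j xi, depending on
    g_i. As f g_i and f g_j are return times, so is g_i^-1 g_j, and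
    g_i^-1 g_j xi is near phi^(j-i) xi. *)
Lemma endo_recurrent (W : set S) : nbhs xi W ->
  exists2 m, 0 < m & W (iter m phi xi).
Proof.
move=> /(regular_closed_nbhs regS)[W' [nW' cW' sW'W]].
have [V nV VW'] := return_times_divl nW'.
have Xphi n : X (iter n phi xi).
  by have [_ H _] := flow_hom_iter n phiX; exact/H/base_hull.
have [z Xz zc] := seq_cluster Xphi.
have [f Vfz] := base_in_orbit_closure Xz (nbhs_interior nV).
have /zc nO := nbhs_act (nbhs_interior Vfz).
have [i _ Oi] := nO 0; have [j ij Oj] := nO i.+1.
exists (j - i)%N; first by rewrite subn_gt0.
apply: sW'W; apply: contrapT => nW'm.
have nN : nbhs (iter (j - i) phi xi) (~` W').
  by apply: open_nbhs_nbhs; split => //; exact: closed_openC.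
have psiX := flow_hom_iter (j - i) phiX.
have nM := flow_hom_nbhs psiX base_hull nN.
have [U nU UM] := xiaa (Xphi i) nM.
have [gi [Ui /= Vgi]] := hull_approx (Xphi i)
  (filterI nU (nbhs_act (nbhs_interior Oi))).
have := UM _ Ui (hull_act (Xphi i)).
have [_ _ ->//] := psiX; rewrite -iterD subnK => [nWj|]; last exact: ltnW.
have nW'j : nbhs (a gi^-1 (iter j phi xi)) (~` W').
  by apply: open_nbhs_nbhs; split => //; exact: closed_openC.
have [gj [/= Wj Vgj]] := hull_approx (Xphi j)
  (filterI (nbhs_act nW'j) (nbhs_act (nbhs_interior Oj))).
apply: Wj; rewrite -aM.
have : W' (a ((f * gi)^-1 * (f * gj)) xi).
  by apply: VW'; rewrite aM; exact: nbhs_singleton.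
by rewrite invgM mulgA mulgVK.
Qed.

(** An r with r xi close to x is written as (r g) g^-1 with g xi close to
    phi^m xi, where phi^m xi is close to xi. Then r g is a return time because
    r phi^m xi = phi^m (r xi) is close to phi^m x = phi^m xi. *)
Lemma endo_fiber_base x : X x -> phi x = phi xi -> x = xi.
Proof.
move=> Xx phix; apply: contrapT => /(hausdorff_disjoint_nbhs hS).
move=> [B [A [nB nA BA]]].
have [V nV VA] := return_times_divr nA.
have [[|m]// _ Vm] := endo_recurrent (nbhs_interior nV).
have psiX := flow_hom_iter m.+1 phiX.
have psix : iter m.+1 phi x = iter m.+1 phi xi by rewrite !iterSr phix.
have nM : nbhs x (fun y => X y -> V° (iter m.+1 phi y)).
  by apply: flow_hom_nbhs => //; rewrite psix; exact: nbhs_interior.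
have [r [Br /(_ (@orbit_hull r)) Vr]] := hull_approx Xx (filterI nB nM).
have [_ psi_im psia] := psiX.
rewrite (psia _ _ base_hull) in Vr.
have [g [Vg Vrg]] := hull_approx (psi_im _ base_hull)
  (filterI Vm (nbhs_act Vr)).
apply: (BA (a r xi)) => //.
have -> : r = (r * g) * g^-1 by rewrite mulgK.
by apply: VA => //; rewrite aM; exact: Vrg.
Qed.

Theorem endo_almost_1_1 : almost_1_1 a X a X phi.
Proof.
split; [exact: phiX | exact: endo_surj | exists xi; first exact: base_hull].
apply/seteqP; split => [x [Xx /= phix]|_ ->]; first exact: endo_fiber_base.
by split => //; exact: base_hull.
Qed.

End Endomorphism.
End Flow.

(** * Nets and filters *)

Lemma tails_proper (I : directedSet) : ProperFilter (tails I).
Proof.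
split=> [[i0 H]|]; first exact: H (dir_refl i0).
split.
- by case: (dir_inhabited I) => i; exists i.
- move=> A B [i Ai] [j Bj]; have [k ik jk] := dir_ub i j.
  by exists k => l kl; split; [exact: Ai (dir_trans ik kl) |
    exact: Bj (dir_trans jk kl)].
- by move=> A B AB [i Ai]; exists i => j /Ai /AB.
Qed.

(** A proper filter as a net: the indices are the pairs (A, x) with x in A and A
    in the filter, ordered by reverse inclusion of A, and the value at (A, x)
    is x. *)
Section FilterNet.
Context {T : Type} (F : set_system T) {PF : ProperFilter F}.

Let point := {p : set T * T | F p.1 /\ p.1 p.2}.
Let le (p q : point) : Prop := (sval q).1 `<=` (sval p).1.

Let point_of (A : set T) (FA : F A) : {p : point | (sval p).1 = A}.
Proof.
by have [x Ax] := cid (filter_ex FA); exists (exist _ (A, x) (conj FA Ax)).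
Qed.

Fact filter_net_inhabited : inhabited point.
Proof. by have [p _] := point_of filterT. Qed.

Fact filter_net_ub (p q : point) : exists2 r, le p r & le q r.
Proof.
have [r rE] := point_of (filterI (proj2_sig p).1 (proj2_sig q).1).
by exists r; rewrite /le rE => x [].
Qed.

Definition filter_net_index : directedSet := @DirectedSet point le
  (fun p => @subset_refl _ _) (fun p q r pq qr => subset_trans qr pq)
  filter_net_inhabited filter_net_ub.

Definition filter_net (p : filter_net_index) : T := (sval p).2.

Lemma filter_net_cofinal (J : directedSet) (h : J -> filter_net_index)
    (A : set T) :
  cofinal h -> F A -> (filter_net (h j) @[j --> tails J]) A.
Proof.
move=> hc FA; have [p pE] := point_of FA.
have [j0 hj0] := hc p; exists j0 => j /hj0; rewrite /= /le pE; apply.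
exact: (proj2_sig (h j)).2.
Qed.
End FilterNet.

(** * Almost automorphic functions *)

(** The left and the right notion are the cases m x t = x t and m x t = t x. *)
Section AlmostAutomorphicFunction.
Context {R : realType} {G : topologicalGroupType}.
Variables (m : G -> G -> G) (f : G -> R[i]^o).

Definition almost_automorphic_for : Prop :=
  forall (I : directedSet) (t : I -> G),
  exists (J : directedSet) (h : J -> I) (phi : G -> R[i]^o),
    [/\ cofinal h, continuous phi,
        forall x, f (m x (t (h j))) @[j --> tails J] --> phi x &
        forall x, phi (m x (t (h j))^-1) @[j --> tails J] --> f x].

Hypothesis faa : almost_automorphic_for.

(** A subnet of the net of a filter F induces a filter finer than F. *)
Lemma almost_automorphic_filter (F : set_system G) : ProperFilter F ->
  exists2 F' : set_system G, ProperFilter F' /\ F `<=` F' &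
  exists phi : G -> R[i]^o,
    (forall x, f (m x t) @[t --> F'] --> phi x) /\
    (forall x, phi (m x t^-1) @[t --> F'] --> f x).
Proof.
move=> PF; have [J [h [phi [hc _ fphi phif]]]] := faa (@filter_net _ F PF).
exists (filter_net (h j) @[j --> tails J]).
  split; last by move=> A; exact: filter_net_cofinal.
  by apply: fmap_proper_filter; exact: tails_proper.
by exists phi; split; [exact: fphi | exact: phif].
Qed.

(** If the convergence fails, some neighbourhood B of f (m s u) is avoided on a
    set D that meets every member of F. Almost automorphy along the elements
    m t u, with t following the restriction of F to D, gives a limit function
    phi and the return of phi to f. The hypothesis on zeta identifies phi with
    zeta, so that zeta (m s t^-1) does enter B. *)
Lemma almost_automorphic_return (F : set_system G) (u : G)
    (zeta : G -> R[i]^o) :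
  ProperFilter F -> associative m ->
  (forall s t, m (m s u) (m t u)^-1 = m s t^-1) ->
  (forall x, f (m (m x t) u) @[t --> F] --> zeta x) ->
  forall s, zeta (m s t^-1) @[t --> F] --> f (m s u).
Proof.
move=> PF mA mK fz s B nB; apply: contrapT => nFB.
pose D : set G := [set t | ~ B (zeta (m s t^-1))].
have PD : ProperFilter (within D F).
  split; last exact: within_filter.
  move=> FD; apply: nFB; apply: (@filterS _ F _ _ _ _ FD) => t Dt.
  by apply: contrapT => /Dt.
have [F' [PF' FF'] [phi [fphi phif]]] :=
  almost_automorphic_filter (fmap_proper_filter (fun t => m t u) PD).
have phiE x : phi x = zeta x.
  apply: (cvg_unique (@norm_hausdorff _ _) (fphi x)) => A /fz FA.
  suff : (m t u @[t --> within D F]) (fun t => A (f (m x t))) by move=> /FF'.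
  by apply: (@filterS _ F _ _ _ _ FA) => t At _ /=; rewrite mA.
have /filter_ex[_ /= [[t Dt <-] Bt]] : F' ([set m t u | t in D] `&`
    [set t | B (phi (m (m s u) t^-1))]).
  apply: filterI; last exact: phif.
  by apply: FF'; apply: nearW => t Dt; exists t.
by apply: Dt; move: Bt; rewrite mK phiE.
Qed.

(** A filter on the closure of the range is pulled back to G through its open
    members, which all meet the range; the almost automorphic limit at e along
    this filter is a cluster point. *)
Lemma almost_automorphic_compact (e : G) : (forall t, m e t = t) ->
  compact (closure (range f)).
Proof.
move=> me F PF FK.
pose F0 := filter_from [set O | open O /\ F O] (fun O => f @^-1` O).
have PF0 : ProperFilter F0.
  apply: filter_from_proper.
    apply: filter_from_filter.
      by exists setT; split; [exact: openT | exact: filterT].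
    move=> O O' [oO FO] [oO' FO']; exists (O `&` O') => //.
    by split; [exact: openI | exact: filterI].
  move=> O [oO FO]; have [x [Kx Ox]] := filter_ex (filterI FK FO).
  have [_ [[t _ <-] Ot]] := Kx _ (open_nbhs_nbhs (conj oO Ox)).
  by exists t.
have [F' [PF' FF'] [phi [fphi _]]] := almost_automorphic_filter PF0.
exists (phi e); split.
  move=> B nB; have [t /= Bt] := @filter_ex _ F' _ _ (fphi e _ nB).
  by exists (f t); split; [exists t | rewrite -[t]me].
move=> A B FA nB; apply: contrapT => /nonemptyPn AB0.
have [B' [nB' cB' sB']] := regular_closed_nbhs uniform_regular nB.
have FB' : F0 (f @^-1` (~` B')).
  exists (~` B') => //; split; first exact: closed_openC.
  apply: filterS FA => x Ax /sB' Bx.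
  by have : (A `&` B) x by []; rewrite AB0.
have F'B : F' (fun t => B' (f (m e t))) by exact: fphi nB'.
have [t [B't]] := filter_ex (filterI F'B (FF' _ FB')).
by apply; rewrite -[t]me.
Qed.

End AlmostAutomorphicFunction.

(** * The hull *)

Section Hull.
Context {R : realType} {G : topologicalGroupType} (f : G -> R[i]^o).
Let S := {ptws G * G -> R[i]^o}.

Lemma cvg_coordinates (F : set_system S) (z : S) : Filter F ->
  (forall st, (x : S) st @[x --> F] --> z st) -> F --> z.
Proof. by move=> FF Fz; apply/pointwise_cvgP. Qed.

Lemma coordinate_continuous (st : G * G) : continuous (fun x : S => x st).
Proof. exact: (@proj_continuous _ (fun=> R[i]^o) st). Qed.

Lemma pointwise_hausdorff : hausdorff_space S.
Proof. by apply: hausdorff_product => _; exact: norm_hausdorff. Qed.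

Lemma hullE_ract : hull f = closure (range (fun t => ract t (xi f))).
Proof. by congr closure; apply: eq_imagel => t _; rewrite lact_xi. Qed.

Lemma lact1 (x : S) : lact 1 x = x.
Proof. by apply/funext => -[s u]; rewrite /lact /biact /= mulg1 mul1g. Qed.

Lemma lactM g h (x : S) : lact (g * h) x = lact g (lact h x).
Proof. by apply/funext => -[s u]; rewrite /lact /biact /= !mul1g mulgA. Qed.

Lemma ract1 (x : S) : ract 1 x = x.
Proof. exact: lact1. Qed.

Lemma ractM g h (x : S) : ract (g * h) x = ract h (ract g x).
Proof. by apply/funext => -[s u]; rewrite /ract /biact /= !mulg1 mulgA. Qed.

Lemma lactE t (x : S) s u : lact t x (s, u) = x (s * t, u).
Proof. by rewrite /lact /biact /= mul1g. Qed.

Lemma ractE t (x : S) s u : ract t x (s, u) = x (s, t * u).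
Proof. by rewrite /ract /biact /= mulg1. Qed.

Lemma biact_continuous (t1 t2 : G) : continuous (fun x : S => biact t1 x t2).
Proof.
move=> x.
apply: (@cvg_coordinates (biact t1 y t2 @[y --> nbhs x]) (biact t1 x t2) _).
move=> st; exact: (@coordinate_continuous (st.1 * t1, t2 * st.2) x).
Qed.

Lemma hull_compact : left_almost_automorphic f -> compact (hull f).
Proof.
move=> faa.
have cK : compact (closure (range f)).
  apply: (@almost_automorphic_compact _ _ (fun x t => x * t) f faa 1) => t.
  by rewrite mul1g.
have cP := @tychonoff (G * G)%type (fun=> R[i]^o) _ (fun=> cK).
apply: (subclosed_compact _ cP); first exact: closed_closure.
move/(compact_closed pointwise_hausdorff): (cP) => /closure_id ->.
apply: closure_subset => _ [t _ <-] [s u]; apply: subset_closure.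
by eexists.
Qed.

(** Convergence along this filter is convergence as b t (xi f) tends to z. *)
Definition visit_filter (b : G -> S -> S) (z : S) : set_system G :=
  filter_from (nbhs z) (fun U t => U (b t (xi f))).

Lemma visit_filter_proper (b : G -> S -> S) z :
  closure (range (fun t => b t (xi f))) z -> ProperFilter (visit_filter b z).
Proof.
move=> Xz; apply: filter_from_proper; last first.
  by move=> U /Xz[_ [[t _ <-] Ut]]; exists t.
apply: filter_from_filter; first by exists setT; exact: filterT.
by move=> U V nU nV; exists (U `&` V) => //; exact: filterI.
Qed.

Lemma visit_filter_cvg (b : G -> S -> S) z st :
  b t (xi f) st @[t --> visit_filter b z] --> z st.
Proof.
move=> B nB.
by exists (fun y => B (y st)) => //; exact: (@coordinate_continuous st z B nB).
Qed.

(** Fix the second coordinate u: the coordinates of t xi are f (x t u), and left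
    almost automorphy applies along the elements t u. *)
Lemma lact_almost_automorphic : left_almost_automorphic f ->
  almost_automorphic_point lact (xi f).
Proof.
move=> faa z Xz.
have PF := visit_filter_proper Xz.
suff H : lact t^-1 z @[t --> visit_filter lact z] --> xi f.
  by move=> W /H[U nU UW]; exists U.
apply: cvg_coordinates => -[s u].
have K s' t : (s' * u) * (t * u)^-1 = s' * t^-1 by rewrite invgM mulgA mulgK.
have H := almost_automorphic_return (m := fun x t => x * t) faa PF (@mulgA _) K.
have zE : (fun t => lact t^-1 z (s, u)) = (fun t => z (s * t^-1, u)).
  by apply/funext => t; rewrite lactE.
change ((fun t => lact t^-1 z (s, u)) @ visit_filter lact z --> f (s * u)).
rewrite zE; apply: (H (fun x => z (x, u))) => x.
have fE : (fun t => f (x * t * u)) = (fun t => lact t (xi f) (x, u)).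
  by apply/funext => t; rewrite lactE.
by rewrite fE; exact: visit_filter_cvg.
Qed.

(** Here the first coordinate s is fixed, and right almost automorphy applies
    along the elements s t. *)
Lemma ract_almost_automorphic : right_almost_automorphic f ->
  almost_automorphic_point ract (xi f).
Proof.
move=> faa z Xz.
have PF := visit_filter_proper Xz.
suff H : ract t^-1 z @[t --> visit_filter ract z] --> xi f.
  by move=> W /H[U nU UW]; exists U.
apply: cvg_coordinates => -[s u].
have mA : associative (fun x t : G => t * x) by move=> x y w; rewrite mulgA.
have K u' t : (s * t)^-1 * (s * u') = t^-1 * u' by rewrite invgM mulgA mulgVK.
have H := almost_automorphic_return (m := fun x t => t * x) faa PF mA K.
have zE : (fun t => ract t^-1 z (s, u)) = (fun t => z (s, t^-1 * u)).
  by apply/funext => t; rewrite ractE.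
change ((fun t => ract t^-1 z (s, u)) @ visit_filter ract z --> f (s * u)).
rewrite zE; apply: (H (fun x => z (s, x))) => x.
have fE : (fun t => f (s * (t * x))) = (fun t => ract t (xi f) (s, x)).
  by apply/funext => t; rewrite ractE.
by rewrite fE; exact: visit_filter_cvg.
Qed.

End Hull.

Theorem theorem6p3p12 (R : realType) (G : topologicalGroupType)
    (lcG : locally_compact [set: G]%classic) (hG : hausdorff_space G)
    (f : G -> R[i]^o) (ff : bochner_aa f) :
  (forall phi, flow_endomorphism lact (hull f) phi ->
     almost_1_1 lact (hull f) lact (hull f) phi) /\
  (forall phi, flow_endomorphism ract (hull f) phi ->
     almost_1_1 ract (hull f) ract (hull f) phi).
Proof.
have [faal faar] := ff; have cX := hull_compact faal.
have regS : regular_space {ptws G * G -> R[i]^o} := uniform_regular.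
have hS := @pointwise_hausdorff R G.
split=> phi phiX.
  apply: (endo_almost_1_1 regS hS lact1 lactM _ cX) => //.
  - by move=> g; exact: biact_continuous.
  - exact: lact_almost_automorphic.
(* [ract] reverses products; composed with the inverse it is a left action, with
   the same orbits and the same endomorphisms. *)
pose a (g : G) := @ract R G g^-1.
have XE : hull f = closure (range (fun t => a t (xi f))).
  rewrite hullE_ract; congr closure; apply/seteqP; split => _ [t _ <-].
    by exists t^-1 => //; rewrite /a invgK.
  by exists t^-1.
have aaa : almost_automorphic_point a (xi f).
  move=> z; rewrite -XE hullE_ract => Xz W nW.
  have [U nU UW] := ract_almost_automorphic faar Xz nW.
  by exists U => // t; exact: UW.
have [phic pX pa] := phiX.
have phiA : flow_hom a (hull f) a (hull f) phi.
  by split => // g x; exact: pa.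
rewrite XE in cX phiA.
have [] := @endo_almost_1_1 G _ a regS hS _ _ _ (xi f) cX aaa phi phiA.
- by move=> x; rewrite /a invg1 ract1.
- by move=> g h x; rewrite /a invgM ractM.
- by move=> g; exact: biact_continuous.
by rewrite -XE => _ surj inj; split.
Qed.
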